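(* If $G$ is a graph of order $n$ and $\overline{G}$ is the complement of $G$, then $$\bigl|\,\|\overline{G}\|_*-\|G\|_*\,\bigr|\le 2n-2.$$ Equality holds if and only if $G$ or $\overline{G}$ is a complete graph.
   Context: Graphs are finite, simple and undirected; the order of a graph is its number of vertices. The energy $\|G\|_*$ of a graph $G$ is the sum of the absolute values of the eigenvalues of its adjacency matrix (counted with multiplicity). *)

(* Defs.v *)
From mathcomp Require Import all_boot all_order all_algebra.

Set Implicit Arguments.
Unset Strict Implicit.
Unset Printing Implicit Defensive.

Import GRing.Theory Num.Theory.
Local Open Scope ring_scope.

Record sgraph := SGraph {
  vertex :> finType;
  adj : rel vertex;
  adj_sym : symmetric adj;
  adj_irrefl : irreflexive adj
}.

Definition graph_order (G : sgraph) : nat := #|G|.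

Definition compl_adj (G : sgraph) : rel G :=
  fun x y => (x != y) && ~~ adj x y.

Lemma compl_adj_sym (G : sgraph) : symmetric (@compl_adj G).
Proof. by move=> x y; rewrite /compl_adj eq_sym adj_sym. Qed.

Lemma compl_adj_irrefl (G : sgraph) : irreflexive (@compl_adj G).
Proof. by move=> x; rewrite /compl_adj eqxx. Qed.

Definition compl_graph (G : sgraph) : sgraph :=
  SGraph (@compl_adj_sym G) (@compl_adj_irrefl G).

Definition complete_graph (G : sgraph) : Prop :=
  forall x y : G, x != y -> adj x y.

Section Energy.
Variable C : numClosedFieldType.

Definition adjmx (G : sgraph) : 'M[C]_#|G| :=
  \matrix_(i, j) (adj (enum_val i) (enum_val j))%:R.

(* The roots of the characteristic polynomial, each listed as many times as
   its algebraic multiplicity; the order of the list is unspecified. *)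
Definition eigenvalues (n : nat) (A : 'M[C]_n) : seq C :=
  sval (closed_field_poly_normal (char_poly A)).

Definition energy (G : sgraph) : C :=
  \sum_(a <- eigenvalues (adjmx G)) `|a|.

End Energy.

(* Main.v *)
Require Import Defs.
From mathcomp Require Import all_boot all_order all_algebra.
From mathcomp Require Import ring.
Set Implicit Arguments.
Unset Strict Implicit.
Unset Printing Implicit Defensive.
Import Order.POrderTheory GRing.Theory Num.Theory.
Local Open Scope ring_scope.

(** The energy is the trace norm of the adjacency matrix, and the adjacency
    matrices M of G and N of its complement satisfy M + N = J - I, where J is
    the all-ones matrix.  As J - I has trace norm 2n - 2, the bound is an
    instance of the triangle inequality; the proof below unfolds the duality
    argument behind that inequality, so that the equality case can be read off.

    Let Q be the orthogonal projection onto the span of the eigenvectors of N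
    with nonnegative eigenvalue.  Then tr ((2Q - I) N) is the trace norm of N
    (norming_projection), and expanding N = J - I - M with tr M = 0 gives

      |N|_* = 2n - 2 + |M|_* - 2 a - 2 b - c,

    where a = tr ((I - Q) J), b = tr Q - 1 and c = |M|_* + tr ((2Q - I) M).
    Each of a, b, c is nonnegative:
    - a is the squared norm of (I - Q) u, with u the all-ones vector;
    - tr Q is the number of nonnegative eigenvalues of N, and there is at least
      one because tr N = 0;
    - 2Q - I is unitary, so the modulus of tr ((2Q - I) M) is at most the trace
      norm of M (norm_mxtrace_unitary_le).

    If equality holds then a = b = c = 0.  From a = 0 the projection Q fixes u,
    and from b = 0 it has rank one, so Q = J / n.  Then c = 0 says that
    |M|_* = - 2 tr (J M) / n, which is at most 0 because the entries of M are
    nonnegative; hence M = 0, that is, the complement of G is complete.  This is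
    trace_norm_complement.  Applying it to G and to its complement bounds the
    difference of energies on both sides.  Conversely, the energy of a complete
    graph is at least 2n - 2 by duality, tested against the reflection
    2 J / n - I. *)

(** * The trace norm of a Hermitian matrix *)

Section TraceNorm.
Variable C : numClosedFieldType.
Local Open Scope sesquilinear_scope.

Definition trace_norm n (M : 'M[C]_n) : C := \sum_(a <- eigenvalues M) `|a|.

Lemma conjtr_mul m n p (A : 'M[C]_(m, n)) (B : 'M[C]_(n, p)) :
  (A *m B)^t* = B^t* *m A^t*.
Proof. by rewrite trmx_mul map_mxM. Qed.

Lemma spectral_decomposition n (M : 'M[C]_n) : M^t* = M ->
  M = (spectralmx M)^t* *m diag_mx (spectral_diag M) *m spectralmx M.
Proof.
move=> herM.
have /orthomx_spectralP {1}-> : M \is normalmx by apply/normalmxP; rewrite herM.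
by rewrite invmx_unitary ?spectral_unitarymx.
Qed.

Lemma spectral_diag_is_real n (M : 'M[C]_n) i : M^t* = M ->
  spectral_diag M 0 i \is Num.real.
Proof.
move=> herM; apply/mxOverP; apply: hermitian_spectral_diag_real.
by apply/is_hermitianmxP; rewrite expr0 scale1r herM.
Qed.

Lemma char_poly_unitary_conj n (P D : 'M[C]_n) : P \is unitarymx ->
  char_poly (P^t* *m D *m P) = char_poly D.
Proof.
move=> Pu; have PtP : P^t* *m P = 1%:M.
  by rewrite -invmx_unitary // mulVmx ?unitarymx_unit.
pose Pp := map_mx polyC P; pose Qp := map_mx polyC (P^t*).
have QP : Qp *m Pp = 1%:M by rewrite -map_mxM PtP map_mx1.
rewrite /char_poly; have -> : char_poly_mx (P^t* *m D *m P) =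
    Qp *m char_poly_mx D *m Pp.
  rewrite /char_poly_mx mulmxBr mulmxBl -/Qp !map_mxM -/Pp -/Qp.
  by rewrite (scalar_mxC _ Qp) -[_ *m Qp *m Pp]mulmxA QP mulmx1.
by rewrite !det_mulmx mulrAC -det_mulmx QP det1 mul1r.
Qed.

(** The unordered list of characteristic roots agrees, up to permutation, with
    the diagonal of a unitary diagonalization: this is how the spectral theorem
    applies to the energy. *)
Lemma trace_normE n (M : 'M[C]_n) : M^t* = M ->
  trace_norm M = \sum_i `|spectral_diag M 0 i|.
Proof.
move=> herM; rewrite /trace_norm /eigenvalues.
case: (closed_field_poly_normal _) => r /= Dr.
have charE : char_poly M = \prod_i ('X - (spectral_diag M 0 i)%:P).
  rewrite {1}(spectral_decomposition herM).
  rewrite char_poly_unitary_conj ?spectral_unitarymx //.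
  rewrite char_poly_trig ?diag_mx_is_trig //.
  by apply: eq_bigr => i _; rewrite mxE eqxx.
have perm_r : perm_eq r [seq spectral_diag M 0 i | i <- index_enum 'I_n].
  apply: prod_XsubC_eq; rewrite big_map -charE Dr.
  by rewrite (monicP (char_poly_monic M)) scale1r.
by rewrite (perm_big _ perm_r) big_map.
Qed.

Lemma trace_norm_eq0 n (M : 'M[C]_n) : M^t* = M -> trace_norm M = 0 -> M = 0.
Proof.
move=> herM; rewrite trace_normE // => /psumr_eq0P d0.
rewrite (spectral_decomposition herM).
suff -> : spectral_diag M = 0 by rewrite linear0 mulmx0 mul0mx.
apply/rowP=> i; rewrite mxE; apply/normr0_eq0.
by apply: d0 => // *; apply: normr_ge0.
Qed.

(** * Duality between the trace norm and unitary matrices *)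

Lemma mxtrace_gram m n (X : 'M[C]_(m, n)) :
  \tr (X *m X^t*) = \sum_i \sum_j `|X i j| ^+ 2.
Proof.
apply: eq_bigr => i _; rewrite mxE; apply: eq_bigr => j _.
by rewrite !mxE normCK.
Qed.

Lemma mxtrace_gram_ge0 m n (X : 'M[C]_(m, n)) : 0 <= \tr (X *m X^t*).
Proof.
by rewrite mxtrace_gram; do 2!apply: sumr_ge0 => ? _; rewrite exprn_ge0.
Qed.

Lemma mxtrace_gram_eq0 m n (X : 'M[C]_(m, n)) : \tr (X *m X^t*) = 0 -> X = 0.
Proof.
rewrite mxtrace_gram => /psumr_eq0P X0; apply/matrixP => i j; rewrite mxE.
apply/normr0_eq0/eqP; rewrite -sqrf_eq0; apply/eqP; move: j isT.
have /psumr_eq0P : \sum_j `|X i j| ^+ 2 = 0.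
  by apply: X0 => // k _; apply: sumr_ge0 => ? _; rewrite exprn_ge0.
by apply=> k _; rewrite exprn_ge0.
Qed.

Lemma unitarymx_entry_le1 n (U : 'M[C]_n) i j : U \is unitarymx ->
  `|U i j| <= 1.
Proof.
move=> /unitarymxP/matrixP/(_ i i); rewrite !mxE eqxx mulr1n => row1.
rewrite -(@expr_le1 _ 2) // -row1 (bigD1 j) //= !mxE -normCK lerDl.
by apply: sumr_ge0 => k _; rewrite !mxE mul_conjC_ge0.
Qed.

(** In an orthonormal eigenbasis of [M] the trace is the sum of the eigenvalues
    weighted by diagonal entries of a unitary matrix, each of modulus at most
    1. *)
Lemma norm_mxtrace_unitary_le n (U M : 'M[C]_n) : U \is unitarymx -> M^t* = M ->
  `|\tr (U *m M)| <= trace_norm M.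
Proof.
move=> Uu herM; rewrite trace_normE // {1}(spectral_decomposition herM).
set P := spectralmx M; have Pu : P \is unitarymx by apply: spectral_unitarymx.
rewrite mulmxA mxtrace_mulC !mulmxA mul_mx_diag.
apply: le_trans (ler_norm_sum _ _ _) _; apply: ler_sum => i _.
rewrite mxE normrM ler_piMl // unitarymx_entry_le1 //.
by rewrite !mul_unitarymx ?trmxC_unitary.
Qed.

Lemma projection_reflection_unitary n (Q : 'M[C]_n) : Q^t* = Q -> Q *m Q = Q ->
  2 *: Q - 1%:M \is unitarymx.
Proof.
move=> herQ idQ; apply/unitarymxP.
have -> : (2 *: Q - 1%:M)^t* = 2 *: Q - 1%:M.
  rewrite linearB /= map_mxB linearZ /= map_mxZ herQ rmorph_nat.
  by rewrite trmx1 map_mx1.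
rewrite mulmxBl mulmxBr mulmx1 mul1mx -scalemxAl -scalemxAr idQ scalerA.
by apply/matrixP=> i j; rewrite !mxE; ring.
Qed.

(** The bound [norm_mxtrace_unitary_le] is attained by a reflection.  The
    eigenvalue 0 is counted in the range of [Q]: the vanishing trace then forces
    at least one nonnegative eigenvalue even when [M = 0], so that [Q] has rank
    at least 1 in all cases. *)
Lemma norming_projection n (M : 'M[C]_n) : (0 < n)%N -> M^t* = M -> \tr M = 0 ->
  exists Q : 'M[C]_n, [/\ Q^t* = Q, Q *m Q = Q, 1 <= \tr Q &
    trace_norm M = \tr ((2 *: Q - 1%:M) *m M)].
Proof.
move=> n_gt0 herM trM; set P := spectralmx M; set d := spectral_diag M.
have PPt : P *m P^t* = 1%:M by apply/unitarymxP/spectral_unitarymx.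
have dreal i : d 0 i \is Num.real by apply: spectral_diag_is_real.
pose e : 'rV[C]_n := \row_i (0 <= d 0 i)%R%:R.
have mulPdiag (a b : 'rV[C]_n) : (P^t* *m diag_mx a *m P) *m
    (P^t* *m diag_mx b *m P) = P^t* *m (diag_mx a *m diag_mx b) *m P.
  by rewrite !mulmxA -[_ *m P *m P^t*]mulmxA PPt mulmx1.
have trPdiag (a : 'rV[C]_n) : \tr (P^t* *m diag_mx a *m P) = \sum_i a 0 i.
  by rewrite mxtrace_mulC mulmxA PPt mul1mx mxtrace_diag.
have DM : M = P^t* *m diag_mx d *m P by apply: spectral_decomposition.
exists (P^t* *m diag_mx e *m P); split.
- rewrite !conjtr_mul trmxCK tr_diag_mx map_diag_mx mulmxA.
  by do 2!f_equal; congr diag_mx; apply/rowP=> i; rewrite !mxE rmorph_nat.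
- rewrite mulPdiag mulmx_diag; do 2!f_equal; congr diag_mx.
  by apply/rowP=> i; rewrite !mxE -natrM mulnb andbb.
- have [i di] : exists i, 0 <= d 0 i.
    apply/existsP; apply: contraT; rewrite negb_exists => /forallP dneg.
    have dlt0 i : d 0 i < 0 by rewrite real_ltNge ?real0.
    have : \tr M < 0.
      rewrite DM trPdiag (bigD1 (Ordinal n_gt0)) //=.
      rewrite ltr_wnDr ?dlt0 //.
      by apply: sumr_le0 => i _; apply: ltW.
    by rewrite trM ltxx.
  rewrite trPdiag (bigD1 i) //= mxE di lerDl.
  by apply: sumr_ge0 => j _; rewrite mxE ler0n.
- rewrite trace_normE // mulmxBl mul1mx -scalemxAl [in RHS]DM mulPdiag.
  rewrite mulmx_diag linearB linearZ /= !trPdiag mulr_sumr -sumrB.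
  apply: eq_bigr => i _; rewrite !mxE -/d.
  by case: (real_ge0P (dreal i)) => _ /=; ring.
Qed.

(** * Hermitian matrices adding up to J - I *)

Lemma ones_sqr n : (const_mx 1 : 'M[C]_n) *m (const_mx 1 : 'M[C]_n) =
  n%:R *: const_mx 1.
Proof.
apply/matrixP=> i j; rewrite !mxE (eq_bigr (fun=> 1)); last first.
  by move=> k _; rewrite !mxE mulr1.
by rewrite sumr_const card_ord mulr1.
Qed.

Lemma ones_conjtr m n : (const_mx 1 : 'M[C]_(m, n))^t* = const_mx 1.
Proof. by apply/matrixP=> i j; rewrite !mxE conjC1. Qed.

Lemma mxtrace_ones n : \tr (const_mx 1 : 'M[C]_n) = n%:R.
Proof.
rewrite /mxtrace (eq_bigr (fun=> 1)); last by move=> i _; rewrite mxE.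
by rewrite sumr_const card_ord.
Qed.

(** For an orthogonal projection [R], the trace of [R *m J] is the squared
    norm of the image of the all-ones vector, because [J] is its Gram matrix. *)
Lemma projection_onesE n (R : 'M[C]_n) (u := const_mx 1 : 'cV[C]_n) :
  R^t* = R -> R *m R = R ->
  \tr (R *m const_mx 1) = \tr ((R *m u) *m (R *m u)^t*).
Proof.
move=> herR idR; rewrite conjtr_mul herR mulmxA [RHS]mxtrace_mulC !mulmxA idR.
rewrite -mulmxA ones_conjtr; congr (\tr (_ *m _)).
by apply/matrixP=> i j; rewrite !mxE big_ord1 !mxE mulr1.
Qed.

(** [2 * a + 2 * b + c] measures how far the triangle inequality is from being
    an equality; see the introduction for the meaning of the three terms. *)
Lemma trace_norm_complement n (M : 'M[C]_n)
    (J := const_mx 1 : 'M[C]_n) (N := J - 1%:M - M) :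
    (0 < n)%N -> M^t* = M -> \tr M = 0 -> 0 <= \tr (J *m M) ->
  trace_norm N <= trace_norm M + (2 * n%:R - 2) /\
  (trace_norm N = trace_norm M + (2 * n%:R - 2) -> M = 0).
Proof.
move=> n_gt0 herM trM JM_ge0.
have herN : N^t* = N.
  by rewrite /N !linearB /= !map_mxB herM trmx1 map_mx1 ones_conjtr.
have trJ : \tr J = n%:R by apply: mxtrace_ones.
have trN : \tr N = 0 by rewrite !linearB /= trM trJ mxtrace1 subrr subr0.
have [Q [herQ idQ trQ normN]] := norming_projection n_gt0 herN trN.
set R := 1%:M - Q.
have herR : R^t* = R by rewrite /R linearB /= map_mxB herQ trmx1 map_mx1.
have idR : R *m R = R.
  by rewrite {2}/R mulmxBr mulmx1 {2}/R mulmxBl mul1mx idQ subrr subr0.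
set a := \tr (R *m J); have a_ge0 : 0 <= a.
  by rewrite /a projection_onesE // mxtrace_gram_ge0.
set b := \tr Q - 1; have b_ge0 : 0 <= b by rewrite subr_ge0.
set z := \tr ((2 *: Q - 1%:M) *m M).
have Dz : z = 2 * \tr (Q *m M).
  by rewrite /z mulmxBl mul1mx -scalemxAl linearB linearZ /= trM subr0.
have defect : trace_norm N = 2 * n%:R - 2 - 2 * a - 2 * b - z.
  rewrite normN /N mulmxBr linearB /= -/z; congr (_ - z).
  rewrite mulmxBl mul1mx -scalemxAl mulmxBr mulmx1 linearB linearZ /=.
  rewrite !linearB /= trJ mxtrace1 subrr subr0 /a /b mulmxBl mul1mx linearB /=.
  by rewrite trJ; ring.
have normN_real : trace_norm N \is Num.real.
  by rewrite ger0_real //; apply: sumr_ge0 => x _; apply: normr_ge0.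
have z_real : z \is Num.real.
  have -> : z = 2 * n%:R - 2 - 2 * a - 2 * b - trace_norm N.
    by rewrite defect; ring.
  by rewrite !realB ?realM ?(ger0_real a_ge0) ?(ger0_real b_ge0).
set c := trace_norm M + z; have c_ge0 : 0 <= c.
  have : `|z| <= trace_norm M.
    apply: norm_mxtrace_unitary_le => //.
    exact: projection_reflection_unitary.
  by rewrite real_ler_norml // => /andP[+ _]; rewrite /c -subr_ge0 opprK addrC.
have defectE : trace_norm M + (2 * n%:R - 2) - trace_norm N =
    2 * a + 2 * b + c by rewrite defect /c; ring.
have a2_ge0 : 0 <= 2 * a by rewrite mulr_ge0.
have b2_ge0 : 0 <= 2 * b by rewrite mulr_ge0.
have ab_ge0 : 0 <= 2 * a + 2 * b by rewrite addr_ge0.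
split=> [|eqN]; first by rewrite -subr_ge0 defectE addr_ge0.
move: defectE; rewrite eqN subrr => /esym/eqP.
rewrite paddr_eq0 // paddr_eq0 // !mulf_eq0 pnatr_eq0 /=.
case/andP=> /andP[/eqP a0 /eqP b0] /eqP c0.
set u := const_mx 1 : 'cV[C]_n.
have Ru : R *m u = 0.
  by apply: mxtrace_gram_eq0; rewrite -projection_onesE.
have DJ : J = u *m u^t*.
  by apply/matrixP=> i j; rewrite ones_conjtr !mxE big_ord1 !mxE mulr1.
have QJ : Q *m J = J.
  have : R *m J = 0 by rewrite DJ mulmxA Ru mul0mx.
  by rewrite mulmxBl mul1mx => /subr0_eq.
have JQ : J *m Q = J.
  by have := congr1 (fun X => X^t*) QJ; rewrite conjtr_mul ones_conjtr herQ.
(* Since Q fixes J on both sides, the squared Hilbert-Schmidt norm of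
   n Q - J is n^2 tr Q - n^2, and tr Q = 1. *)
have nQ : n%:R *: Q = J.
  apply: subr0_eq; apply: mxtrace_gram_eq0.
  rewrite linearB /= map_mxB linearZ /= map_mxZ herQ rmorph_nat ones_conjtr -/J.
  rewrite mulmxBl !mulmxBr -!scalemxAl -!scalemxAr idQ QJ JQ ones_sqr -/J.
  rewrite subrr subr0 linearB !linearZ /= trJ.
  by move/eqP: b0; rewrite subr_eq0 => /eqP ->; ring.
apply: trace_norm_eq0 => //.
apply/eqP; rewrite eq_le; apply/andP; split; last first.
  by apply: sumr_ge0 => x _; apply: normr_ge0.
have -> : trace_norm M = - (2 * \tr (Q *m M)).
  by apply/eqP; rewrite -Dz -addr_eq0 -/c c0.
rewrite oppr_le0 pmulr_rge0 // -(pmulr_rge0 _ (x := n%:R)) ?ltr0n //.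
by rewrite -linearZ /= scalemxAl nQ.
Qed.

Lemma trace_norm0 n : (0 < n)%N -> trace_norm (0 : 'M[C]_n) = 0.
Proof.
move=> n_gt0; have her0 : (0 : 'M[C]_n)^t* = 0 by rewrite trmx0 map_mx0.
have [Q [_ _ _ ->]] := norming_projection n_gt0 her0 (mxtrace0 _ _).
by rewrite mulmx0 mxtrace0.
Qed.

(** The upper bound is the case [M = 0] of [trace_norm_complement]; the lower
    bound is duality tested against the reflection that fixes the all-ones
    vector, which spares the computation of the spectrum of [J - I]. *)
Lemma trace_norm_ones_sub1 n : (0 < n)%N ->
  trace_norm (const_mx 1 - 1%:M : 'M[C]_n) = 2 * n%:R - 2.
Proof.
move=> n_gt0; set J := const_mx 1 : 'M[C]_n.
have n_neq0 : n%:R != 0 :> C by rewrite pnatr_eq0 -lt0n.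
have trJ : \tr J = n%:R by apply: mxtrace_ones.
apply/eqP; rewrite eq_le; apply/andP; split.
  have her0 : (0 : 'M[C]_n)^t* = 0 by rewrite trmx0 map_mx0.
  have [] := trace_norm_complement n_gt0 her0 (mxtrace0 _ _).
    by rewrite mulmx0 mxtrace0.
  by rewrite subr0 trace_norm0 // add0r.
pose P := n%:R^-1 *: J.
have herP : P^t* = P.
  by rewrite /P linearZ /= map_mxZ fmorphV rmorph_nat ones_conjtr.
have PJ : P *m J = J by rewrite -scalemxAl ones_sqr scalerA mulVf // scale1r.
have idP : P *m P = P by rewrite {2}/P -scalemxAr PJ.
have trP : \tr P = 1 by rewrite linearZ /= trJ mulVf.
have herJ1 : (J - 1%:M)^t* = J - 1%:M.
  by rewrite linearB /= map_mxB trmx1 map_mx1 ones_conjtr.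
have := norm_mxtrace_unitary_le (projection_reflection_unitary herP idP) herJ1.
have -> : \tr ((2 *: P - 1%:M) *m (J - 1%:M)) = 2 * n%:R - 2.
  rewrite mulmxBl mul1mx -scalemxAl mulmxBr mulmx1 PJ linearB linearZ /=.
  by rewrite !linearB /= trP trJ mxtrace1; ring.
by rewrite ger0_norm // subr_ge0 ler_peMr // ler1n.
Qed.

(** * Adjacency matrices and energies *)

Lemma adjmx_conjtr G : (adjmx C G)^t* = adjmx C G.
Proof. by apply/matrixP=> i j; rewrite !mxE adj_sym rmorph_nat. Qed.

Lemma mxtrace_adjmx G : \tr (adjmx C G) = 0.
Proof. by apply: big1 => i _; rewrite mxE adj_irrefl. Qed.

Lemma mxtrace_ones_adjmx_ge0 G : 0 <= \tr (const_mx 1 *m adjmx C G).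
Proof.
apply: sumr_ge0 => i _; rewrite mxE.
by apply: sumr_ge0 => k _; rewrite !mxE mul1r ler0n.
Qed.

Lemma adjmx_compl G :
  adjmx C (compl_graph G) = const_mx 1 - 1%:M - adjmx C G.
Proof.
apply/matrixP=> i j; rewrite !mxE /= /compl_adj (inj_eq enum_val_inj).
have [->|_] := eqVneq; first by rewrite adj_irrefl subrr subr0.
by case: adj; rewrite /= ?subr0 ?subrr.
Qed.

Lemma adjmx_eq0P G : adjmx C G = 0 <-> complete_graph (compl_graph G).
Proof.
split=> [/matrixP A0 x y /= neq_xy|compG].
  have := A0 (enum_rank x) (enum_rank y); rewrite !mxE !enum_rankK /compl_adj.
  by move/eqP; rewrite pnatr_eq0 eqb0 neq_xy.
apply/matrixP=> i j; rewrite !mxE; have [->|neq_ij] := eqVneq i j.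
  by rewrite adj_irrefl.
rewrite -(inj_eq enum_val_inj) in neq_ij.
by have /= := compG _ _ neq_ij; rewrite /compl_adj neq_ij /= => /negbTE ->.
Qed.

(** The double complement is not definitionally the original graph, but it has
    the same adjacency matrix; this transfers each estimate from [G] to its
    complement. *)
Lemma adjmx_complK G : adjmx C (compl_graph (compl_graph G)) = adjmx C G.
Proof. by rewrite !adjmx_compl subKr. Qed.

Lemma adjmx_compl_eq0P G : adjmx C (compl_graph G) = 0 <-> complete_graph G.
Proof.
rewrite adjmx_eq0P; split=> compG x y neq_xy; have := compG x y neq_xy => /=.
  by rewrite /compl_adj /= /compl_adj neq_xy /= negbK.
by rewrite /compl_adj /= /compl_adj neq_xy /= => ->.
Qed.

Lemma energy_complK G :
  energy C (compl_graph (compl_graph G)) = energy C G.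
Proof. by rewrite /energy adjmx_complK. Qed.

Lemma energy_compl_le (G : sgraph) : (0 < #|G|)%N ->
  energy C (compl_graph G) <= energy C G + (2 * #|G|%:R - 2) /\
  (energy C (compl_graph G) = energy C G + (2 * #|G|%:R - 2) ->
   complete_graph (compl_graph G)).
Proof.
move=> G_gt0; have := trace_norm_complement G_gt0 (adjmx_conjtr G)
  (mxtrace_adjmx G) (mxtrace_ones_adjmx_ge0 G).
by rewrite -adjmx_compl => -[leN eqN]; split=> // /eqN/adjmx_eq0P.
Qed.

Lemma energy_compl_complete (G : sgraph) : (0 < #|G|)%N ->
  complete_graph (compl_graph G) ->
  energy C (compl_graph G) - energy C G = 2 * #|G|%:R - 2.
Proof.
move=> G_gt0 /adjmx_eq0P A0; rewrite /energy adjmx_compl A0 subr0.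
rewrite -![\sum_(_ <- _) _]/(trace_norm _) trace_norm0 //.
by rewrite trace_norm_ones_sub1 // subr0.
Qed.

Lemma energy_real G : energy C G \is Num.real.
Proof. by rewrite ger0_real //; apply: sumr_ge0 => x _; apply: normr_ge0. Qed.
End TraceNorm.

Theorem proposition10 (C : numClosedFieldType) (n : nat) (n_gt0 : (0 < n)%N)
    (G : sgraph) (order_G : graph_order G = n) :
  `|energy C (compl_graph G) - energy C G| <= 2 * n%:R - 2 /\
  (`|energy C (compl_graph G) - energy C G| = 2 * n%:R - 2 <->
   complete_graph G \/ complete_graph (compl_graph G)).
Proof.
rewrite -order_G /graph_order in n_gt0 *.
have [le1 eq1] := energy_compl_le C n_gt0.
have [] := energy_compl_le C (n_gt0 : 0 < #|compl_graph G|)%N.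
rewrite !energy_complK => le2 eq2.
have diff_real : energy C (compl_graph G) - energy C G \is Num.real.
  by rewrite rpredB ?energy_real.
have c_ge0 : 0 <= 2 * #|G|%:R - 2 :> C.
  by rewrite subr_ge0 ler_peMr // ler1n.
split; first by rewrite real_ler_norml // lerBlDl le1 lerBrDl lerBlDr le2.
split=> [|[compG|compG]].
- case: (real_ge0P diff_real) => _ /eqP.
    by rewrite subr_eq addrC => /eqP/eq1; right.
  rewrite opprB subr_eq addrC => /eqP/eq2 /(adjmx_eq0P C)/=.
  by rewrite adjmx_compl_eq0P; left.
- have compG' : complete_graph (compl_graph (compl_graph G)).
    by apply/(adjmx_eq0P C)/adjmx_compl_eq0P.
  have := energy_compl_complete C (n_gt0 : 0 < #|compl_graph G|)%N compG'.
  by rewrite energy_complK distrC => ->; rewrite ger0_norm.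
- by rewrite energy_compl_complete // ger0_norm.
Qed.
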